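(* Let $1\le n\le N$ be integers, let the order of the keys in the keyring be a uniformly random permutation of $\{1,\dots,N\}$, and let $T_{n,N}$ be the number of trials needed to open all $n$ locks with the lock-by-lock strategy. Then $$E(T_{n,N})=\frac{n(2N+3-n)}{4}\quad\text{and}\quad \mathrm{Var}(T_{n,N})=\frac{n(6N^2-6Nn+6N+2n^2-3n-5)}{72}.$$ In particular, when $N=n$, $$E(T_{n,n})=\frac{n(n+3)}{4}\quad\text{and}\quad \mathrm{Var}(T_{n,n})=\frac{n(2n+5)(n-1)}{72}.$$
   Context: There are $n$ locks, numbered $1,\dots,n$, and a keyring with $N\ge n$ keys, numbered $1,\dots,N$. For $1\le i\le n$, key $i$ opens lock $i$ and no other lock; keys $n+1,\dots,N$ open no lock. The person opening the locks does not know the numbers of the keys. The initial condition is a permutation $\sigma$ of $\{1,\dots,N\}$, drawn uniformly from the $N!$ permutations: the key in position $j$ of the keyring is key $\sigma(j)$. A trial consists of trying one key in one lock; the trial in which the key opens the lock is counted, and a trial is counted even if its outcome could be deduced in advance. Once a key has opened a lock, both the key and the lock are discarded; the remaining keys are those not discarded. Lock-by-lock strategy: treat the locks in the order $1,2,\dots,n$. For the current lock, try the remaining keys one after another in keyring order (increasing position), starting from the first remaining key, until the key opening the lock is found (this last trial being counted); then discard this lock and key and pass to the next lock, starting over with the first remaining key. $T_{n,N}$ is the total number of trials when all $n$ locks have been opened. *)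

(* Defs.v *)
From HB Require Import structures.
From mathcomp Require Import all_boot all_order all_algebra all_fingroup.
From mathcomp Require Import all_classical all_reals all_analysis.

Set Implicit Arguments.
Unset Strict Implicit.
Unset Printing Implicit Defensive.

(* Locks, keys and positions are numbered from 0: the locks are the elements of
   'I_n, the keys and the positions those of 'I_N. *)

Definition opens (n N : nat) (i : 'I_n) (k : 'I_N) : bool := val k == val i.

(* Position j carries key s j. *)
Definition keyring (N : nat) (s : 'S_N) : seq 'I_N := [seq s j | j <- enum 'I_N].

(* If the first key of ring opening lock i is at index p (counted from 0), this
   lock costs p.+1 trials, and the key at index p leaves the keyring while the
   others keep their order. *)
Fixpoint trials_from (n N : nat) (locks : seq 'I_n) (ring : seq 'I_N) : nat :=
  match locks with
  | [::] => 0
  | i :: locks' =>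
      let p := find (opens i) ring in
      p.+1 + trials_from locks' (take p ring ++ drop p.+1 ring)
  end.

Definition trials (n N : nat) (s : 'S_N) : nat :=
  trials_from (enum 'I_n) (keyring s).

(* sigma need only be defined on an arbitrary probability space; 'S_N carries
   the discrete sigma-algebra, so that, 'S_N being finite, measurability of
   sigma is measurability of its fibers. *)
Definition uniform_perm (d : measure_display) (Omega : measurableType d)
    (R : realType) (P : probability Omega R) (N : nat) (sigma : Omega -> 'S_N) :=
  forall s : 'S_N,
    measurable (sigma @^-1` [set s])%classic /\
    P (sigma @^-1` [set s])%classic = ((N`!)%:R^-1)%:E%R.

(* Main.v *)
Require Import Defs.
From HB Require Import structures.
From mathcomp Require Import all_boot all_order all_algebra all_fingroup.
From mathcomp Require Import all_classical all_reals all_analysis.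
From mathcomp Require Import measurable_realfun ring.

Import GRing.Theory Num.Theory.

Local Open Scope ring_scope.

(** With [m] keys left, the lock at hand costs [p.+1] trials, where [p] is the
    position of its key among them, from 0. Deleting that key maps the orders of the
    [m] keys onto pairs ([p], order of the [m.-1] other keys), bijectively, so
    [p.+1] is uniform on [1 .. m] and independent of the trials for the later
    locks. Hence the mean of [T] is the sum of the [(m + 1) / 2], and its
    variance the sum of the [(m ^ 2 - 1) / 12], for [N - n < m <= N]. *)

(** Filtering [x] out of the enlarged list returns [t], and the index of [x] returns [p], so
    distinct pairs give distinct lists; [rem x u] and [index x u] form the preimage of [u]. *)
Lemma perm_permutations_cons (T : eqType) (x : T) (s : seq T) : x \notin s ->
  perm_eq (permutations (x :: s))
    [seq take p t ++ x :: drop p t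
       | t <- permutations s, p <- iota 0 (size s).+1].
Proof.
move=> xs.
have xt t : t \in permutations s -> x \notin t.
  by rewrite mem_permutations => /perm_mem ->.
have ct t p : perm_eq (take p t ++ x :: drop p t) (x :: t).
  rewrite -[x :: drop p t]cat1s -[x :: t]cat1s -{3}(cat_take_drop p t).
  by rewrite perm_catCA.
apply: uniq_perm; first exact: permutations_uniq.
- apply: allpairs_uniq; [exact: permutations_uniq|exact: iota_uniq|].
  move=> [t p] [t' p'] /allpairsP[[t1 p1] [ht hp [-> ->]]].
  move=> /allpairsP[[t2 p2] [ht' hp' [-> ->]]] /= E.
  have filterE u q : u \in permutations s ->
      [seq y <- take q u ++ x :: drop q u | y != x] = u.
    move=> hu; rewrite filter_cat /= eqxx -filter_cat cat_take_drop.
    by apply/all_filterP/allP => y yu; apply: contraNneq (xt _ hu) => <-.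
  have idxE u q : u \in permutations s -> q \in iota 0 (size s).+1 ->
      index x (take q u ++ x :: drop q u) = q.
    move=> hu; rewrite mem_iota => /andP[_ hq].
    rewrite index_cat ifN; last by apply: contra (xt _ hu); exact: mem_take.
    rewrite /= eqxx addn0 size_takel //.
    by move: hu; rewrite mem_permutations => /perm_size ->.
  by congr (_, _); [rewrite -(filterE t1 p1 ht) E filterE|
                    rewrite -(idxE t1 p1 ht hp) E idxE].
- move=> u; rewrite mem_permutations; apply/idP/allpairsP; last first.
    move=> [[t p] /= [ht _ ->]]; apply: perm_trans (ct t p) _.
    by rewrite perm_cons -mem_permutations.
  move=> hu.
  have xu : x \in u by rewrite (perm_mem hu) mem_head.
  have su := perm_size hu.
  have lt : (index x u < size u)%N by rewrite index_mem.
  have st : size (take (index x u) u) = index x u by rewrite size_takel // ltnW.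
  exists (rem x u, index x u) => /=; split.
  + rewrite mem_permutations -(perm_cons x); apply: perm_trans hu.
    by rewrite perm_sym; exact: perm_to_rem.
  + by rewrite -[0%N :: _]/(iota 0 (size (x :: s))) mem_iota -su.
  + rewrite remE take_cat drop_cat st ltnn subnn take0 drop0 cats0.
    by rewrite -{1}(cat_take_drop (index x u) u) (drop_nth x) // nth_index.
Qed.

(** No key but [k] carries the number of lock [i], so the search stops exactly at [p], and
    discarding that key undoes the insertion: the later locks see [ring] whatever [p] is. *)
Lemma trials_from_insert (n N : nat) (i : 'I_n) (locks : seq 'I_n) (k : 'I_N)
    (ring : seq 'I_N) (p : nat) :
  opens i k -> k \notin ring -> (p <= size ring)%N ->
  trials_from (i :: locks) (take p ring ++ k :: drop p ring) =
  (p.+1 + trials_from locks ring)%N.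
Proof.
move=> ik kr hp /=.
have fE : find (opens i) (take p ring ++ k :: drop p ring) = p.
  rewrite find_cat /= ik size_takel // addn0 ifN //.
  apply: contra kr => /hasP[j /mem_take hj ij].
  suff -> : k = j by [].
  by apply: val_inj; rewrite (eqP ik) (eqP ij).
rewrite fE take_cat drop_cat size_takel // ltnn subnn take0 cats0 ltnNge leqnSn.
by rewrite /= subSnn /= drop0 cat_take_drop.
Qed.

Lemma sum_succ (R : numFieldType) (m : nat) :
  \sum_(0 <= p < m) (p.+1%:R : R) = m%:R * (m%:R + 1) / 2.
Proof.
elim: m => [|m IH]; first by rewrite big_nil mul0r mul0r.
by rewrite big_nat_recr //= IH -natr1; field.
Qed.

Lemma sum_succ_sq (R : numFieldType) (m : nat) :
  \sum_(0 <= p < m) (p.+1%:R ^+ 2 : R) =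
  m%:R * (m%:R + 1) * (2 * m%:R + 1) / 6.
Proof.
elim: m => [|m IH]; first by rewrite big_nil !mul0r.
by rewrite big_nat_recr //= IH -natr1; field.
Qed.

Definition trials_mean (R : numFieldType) (n N : nat) : R :=
  n%:R * (2 * N%:R + 3 - n%:R) / 4.

Definition trials_var (R : numFieldType) (n N : nat) : R :=
  n%:R * (6 * N%:R ^+ 2 - 6 * N%:R * n%:R + 6 * N%:R + 2 * n%:R ^+ 2
          - 3 * n%:R - 5) / 72.

(* Quadratic polynomials in the number of trials are stable under averaging over
   the position of one key, so the first two moments are computed together. *)
Lemma sum_permutations_quadratic (R : numFieldType) (n N : nat)
    (locks : seq 'I_n) (keys : seq 'I_N) (a b c : R) :
  uniq locks -> uniq keys ->
  (forall i, i \in locks -> exists2 k, k \in keys & opens i k) ->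
  \sum_(r <- permutations keys)
    (a * (trials_from locks r)%:R ^+ 2 + b * (trials_from locks r)%:R + c) =
  (size keys)`!%:R *
    (a * (trials_var R (size locks) (size keys)
          + trials_mean R (size locks) (size keys) ^+ 2)
     + b * trials_mean R (size locks) (size keys) + c).
Proof.
(* The coefficients stay general, since averaging over the position of one key changes [b] and
   [c]. *)
elim: locks keys a b c => [|i locks IH] keys a b c.
  move=> _ Uk _; rewrite /= big_const_seq count_predT size_permutations //.
  by rewrite iter_addr_0 -mulr_natl /trials_var /trials_mean; field.
move=> /andP[il Ul] Uk hk.
have [k kk ik] := hk i (mem_head _ _).
set s := rem k keys.
have ks : perm_eq keys (k :: s) by exact: perm_to_rem.
have [knots Us] : k \notin s /\ uniq s.
  by apply/andP; move: Uk; rewrite (perm_uniq ks).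
(* Key [k] opens only [i], which is absent from [locks], so every later lock keeps its key in
   [s]. *)
have hs j : j \in locks -> exists2 k', k' \in s & opens j k'.
  move=> jl; have [|k' k'k jk'] := hk j; first by rewrite inE jl orbT.
  exists k' => //; move: k'k; rewrite (perm_mem ks) inE => /orP[/eqP k'E|//].
  move: il; suff -> : i = j by rewrite jl.
  by apply: val_inj; rewrite -(eqP ik) -(eqP jk') k'E.
rewrite (perm_big _ (perm_permutations ks)) /= (perm_size ks) /=.
rewrite (perm_big _ (perm_permutations_cons _ _ _ knots)).
rewrite big_allpairs_dep.
set M := (size s).+1.
(* With [y] trials for the later locks, the total is [p.+1 + y]. Over [p < M], [p.+1] has mean
   [(M + 1) / 2] and mean square [(M + 1) (2 M + 1) / 6]; [b'] and [c'] are the resulting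
   coefficient of [y] and constant term. *)
pose b' := a * (M%:R + 1) + b.
pose c' := a * (M%:R + 1) * (2 * M%:R + 1) / 6 + b * (M%:R + 1) / 2 + c.
transitivity (\sum_(t <- permutations s) M%:R *
   (a * (trials_from locks t)%:R ^+ 2 + b' * (trials_from locks t)%:R + c')).
  apply: eq_big_seq => t; rewrite mem_permutations => ts.
  set y := (trials_from locks t)%:R.
  transitivity (\sum_(0 <= p < M)
      (a * p.+1%:R ^+ 2 + (2 * a * y + b) * p.+1%:R + (a * y ^+ 2 + b * y + c))).
    rewrite /index_iota subn0; apply: eq_big_seq => p.
    rewrite mem_iota add0n => /andP[_ hp].
    rewrite -/(trials_from (i :: locks) _) trials_from_insert //.
    - by rewrite natrD -/y; ring.
    - by rewrite (perm_mem ts).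
    - by rewrite (perm_size ts).
  rewrite !big_split /= !sumr_const_nat subn0.
  rewrite -!mulr_sumr sum_succ sum_succ_sq /b' /c'.
  by field.
(* The factor [M] completes the factorial. The rest is a polynomial identity: the new lock and key
   add [(M + 1) / 2] to the mean and [(M ^ 2 - 1) / 12] to the variance. *)
rewrite -mulr_sumr IH // factS natrM /b' /c' /M /trials_var /trials_mean -!natr1.
by field.
Qed.

(** Surjectivity comes from counting: [keyring] is injective with values among the orders of the
    keys, and both lists have N! entries. *)
Lemma perm_keyrings (N : nat) :
  perm_eq [seq keyring s | s <- enum 'S_N] (permutations (enum 'I_N)).
Proof.
have inj : injective (@keyring N).
  move=> s t st; apply/permP => j.
  by have /eq_in_map -> : map s (enum 'I_N) = map t (enum 'I_N) by []; rewrite ?mem_enum.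
have U : uniq [seq keyring s | s <- enum 'S_N] by rewrite map_inj_uniq ?enum_uniq.
apply: uniq_perm => //; first exact: permutations_uniq.
apply: (uniq_min_size U _ _).2.
- move=> _ /mapP[s _ ->]; rewrite mem_permutations; apply: uniq_perm.
  + by rewrite map_inj_uniq ?enum_uniq //; exact: perm_inj.
  + exact: enum_uniq.
  + move=> k; rewrite mem_enum; apply/mapP; exists (s^-1 k)%g; rewrite ?mem_enum //.
    by rewrite permKV.
- rewrite size_permutations ?enum_uniq // size_enum_ord.
  by rewrite size_map -cardE card_Sn.
Qed.

Lemma mean_trials_quadratic (R : numFieldType) (n N : nat) (a b c : R) :
  (n <= N)%N ->
  (\sum_(s : 'S_N) (a * (trials n s)%:R ^+ 2 + b * (trials n s)%:R + c)) / N`!%:R =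
  a * (trials_var R n N + trials_mean R n N ^+ 2) + b * trials_mean R n N + c.
Proof.
move=> hN; rewrite /trials -big_enum /=.
pose f (r : seq 'I_N) : R := a * (trials_from (enum 'I_n) r)%:R ^+ 2
                + b * (trials_from (enum 'I_n) r)%:R + c.
rewrite -(big_map (@keyring N) xpredT f) (perm_big _ (perm_keyrings N)) /f.
rewrite sum_permutations_quadratic ?enum_uniq ?size_enum_ord //.
- by rewrite mulrC mulKf // pnatr_eq0 -lt0n fact_gt0.
- move=> i _; exists (widen_ord hN i); first by rewrite mem_enum.
  exact: eqxx.
Qed.

(** The integrand is a finite sum of indicators of the fibers of [sigma], weighted by the [g s], and
    each fiber has probability 1/N!. As [g] is nonnegative, measurability of the fibers suffices to
    split the integral. *)
Lemma expectation_uniform_perm (R : realType) (N : nat) (d : measure_display)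
    (Omega : measurableType d) (P : probability Omega R) (sigma : Omega -> 'S_N)
    (g : 'S_N -> R) :
  uniform_perm P sigma -> (forall s, 0 <= g s) ->
  ('E_P[fun w => g (sigma w)])%E = ((\sum_s g s) / N`!%:R)%:E.
Proof.
move=> hsigma g0; rewrite unlock.
transitivity (\int[P]_w \sum_(s : 'S_N)
    (g s)%:E * (\1_(sigma @^-1` [set s]) w)%:E)%E.
  apply: eq_integral => w _; rewrite (bigD1 (sigma w)) //= big1 => [|s sw].
    by rewrite indicE mem_set //= mule1 adde0.
  rewrite indicE memNset ?mule0 //= => E.
  by rewrite E eqxx in sw.
rewrite ge0_integral_sum //=; last 2 first.
- move=> s; apply/measurable_EFinP; apply: measurable_funM => //.
  by apply: measurable_indic; have [] := hsigma s.
- by move=> s w _; rewrite mule_ge0 ?lee_fin.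
rewrite mulr_suml -sumEFin; apply: eq_bigr => s _.
have [ms Ps] := hsigma s.
rewrite ge0_integralZl //=.
- by rewrite integral_indic // setIT [X in (_ * X)%E]Ps EFinM.
- by apply/measurable_EFinP; apply: measurable_indic.
- by rewrite lee_fin.
Qed.

Theorem mainTheorem3 (R : realType) (n N : nat) (hn : (1 <= n)%N) (hN : (n <= N)%N)
    (d : measure_display) (Omega : measurableType d) (P : probability Omega R)
    (sigma : Omega -> 'S_N) (hsigma : uniform_perm P sigma) :
  let T : Omega -> R := fun w => (trials n (sigma w))%:R in
  [/\ ('E_P[T])%E = (n%:R * (2 * N%:R + 3 - n%:R) / 4)%:E,
      ('V_P[T])%E =
        (n%:R * (6 * N%:R ^+ 2 - 6 * N%:R * n%:R + 6 * N%:R + 2 * n%:R ^+ 2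
                 - 3 * n%:R - 5) / 72)%:E
    & N = n ->
        ('E_P[T])%E = (n%:R * (n%:R + 3) / 4)%:E /\
        ('V_P[T])%E = (n%:R * (2 * n%:R + 5) * (n%:R - 1) / 72)%:E].
Proof.
move=> T; pose mu := trials_mean R n N.
have ET : ('E_P[T])%E = mu%:E.
  rewrite (expectation_uniform_perm _ _ _ _ _ _ (fun s => (trials n s)%:R) hsigma)//.
  congr EFin; have := mean_trials_quadratic R n N 0 1 0 hN.
  rewrite !mul0r add0r mul1r addr0 -/mu => <-; congr (_ / _).
  by apply: eq_bigr => s _; rewrite mul0r add0r mul1r addr0.
have VT : ('V_P[T])%E = (trials_var R n N)%:E.
  rewrite /variance covariance.unlock ET /=.
  (* Written as a square, the integrand is a nonnegative function of [sigma w], as the expectation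
     lemma demands. *)
  rewrite [X in ('E_P[X])%E](_ : _ = fun w => ((trials n (sigma w))%:R - mu) ^+ 2);
    last by apply/funext => w; rewrite expr2.
  rewrite (expectation_uniform_perm _ _ _ _ _ _
             (fun s => ((trials n s)%:R - mu) ^+ 2) hsigma); last first.
    by move=> s; exact: sqr_ge0.
  congr EFin.
  (* Coefficients [1], [- 2 * mu], [mu ^+ 2] expand the square; the terms in [mu ^+ 2] then cancel,
     leaving [trials_var]. *)
  transitivity ((\sum_(s : 'S_N) (1 * (trials n s)%:R ^+ 2
     + (- 2 * mu) * (trials n s)%:R + mu ^+ 2)) / N`!%:R).
    by congr (_ / _); apply: eq_bigr => s _; ring.
  by rewrite mean_trials_quadratic // -/mu; ring.
split; [exact: ET|exact: VT|move=> NE].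
(* At [N = n] the variance factor becomes [2 n ^ 2 + 3 n - 5 = (2 n + 5) (n - 1)]. *)
rewrite ET VT /mu /trials_mean /trials_var NE.
by split; congr EFin; field.
Qed.
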